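(* Let $W\subseteq\mathcal{L}_\Sigma$ be finite, let $(D_0,V)\in\mathcal{D}(W)$ and let $T=(D,V)\in\mathcal{D}^*(W)$ be its restriction, $D=\{\delta_1,\ldots,\delta_n\}$, with selector variables $G=\{g_1,\ldots,g_n\}$ as occurring in $\mathit{Ext}[T]$ and $\mathit{Conseq}[T,\cdot]$; let $\varphi\in\mathcal{L}_\Sigma$, and let $\vdash_c,\vdash_s,\vdash_p$ be the credulous, skeptical and prudent unsigned consequence relations with respect to $(D_0,V)$. Then (1) $W\vdash_c\varphi$ iff $\models\exists G(\mathit{Ext}[T]\wedge\mathit{Conseq}[T,\varphi])$; (2) $W\vdash_s\varphi$ iff $\models\neg\exists G(\mathit{Ext}[T]\wedge\neg\mathit{Conseq}[T,\varphi])$; (3) letting $G'=\{g'_1,\ldots,g'_n\}$ be further new variables, $\Psi=\bigwedge_{i=1}^n\big(\neg g'_i\to\exists G(\mathit{Ext}[T]\wedge\neg\mathit{Conseq}[T,c(\delta_i)])\big)$, and $\mathit{Conseq}_{G\leftarrow G'}[T,\varphi]$ the QBF obtained from $\mathit{Conseq}[T,\varphi]$ by replacing each $g_i$ by $g'_i$, we have $W\vdash_p\varphi$ iff $\models\neg\exists G'(\neg\mathit{Conseq}_{G\leftarrow G'}[T,\varphi]\wedge\Psi)$.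
   Context: Propositional logic over $\Sigma$, $\mathcal{L}_\Sigma$, $\mathit{var}$, $\mathit{Cn}$ as usual; finite sets identified with conjunctions; occurrence polarity as usual. $\Sigma^\pm=\{p^+,p^-\mid p\in\Sigma\}$ fresh; $\alpha^\pm$ replaces positive occurrences of $p$ by $p^+$ and negative ones by $\neg p^-$. Default $\delta=\frac{\alpha:\beta}{\gamma}$, $j(\delta)=\beta$, $c(\delta)=\gamma$. Extensions of $(D,V)$: $E_1=V$, $E_{n+1}=\mathit{Cn}(E_n)\cup\{\gamma\mid\frac{\alpha:\beta}{\gamma}\in D,\alpha\in E_n,\neg\beta\notin E\}$; $E$ extension iff $E=\bigcup_nE_n$. $\delta_p=\frac{\top:p^+\equiv\neg p^-}{(p\equiv p^+)\wedge(\neg p\equiv p^-)}$, $D_\Sigma=\{\delta_p\mid p\in\Sigma\}$. Index set $I$: distinct indices for all atom occurrences in $W$; $p$ has complementary occurrences if it occurs positively and negatively in $W$; $W^\pm_I$ replaces, for such $p$, $p^+$/$p^-$ from occurrence $i$ by fresh $p^+_i$/$p^-_i$. $D^1_\Sigma$: for such $p$, $\frac{\top:(p\equiv p^+_i)\wedge(\neg p\equiv p^-_j)}{(p\equiv p^+_i)\wedge(\neg p\equiv p^-_j)}$ ($i$ positive, $j$ negative index), $\delta_p$ otherwise. $D^2_\Sigma$: for such $p$, $\frac{\top:p\equiv p^+_i}{p\equiv p^+_i}$ and $\frac{\top:\neg p\equiv p^-_j}{\neg p\equiv p^-_j}$, $\delta_p$ otherwise. $\mathcal{D}(W)=\{(D_\Sigma,W^\pm)\}\cup\{(D^1_\Sigma,W^\pm_I),(D^2_\Sigma,W^\pm_I)\mid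 I\}$; the restriction of $(D_0,V)$ is $(D,V)$ with $D=\{\delta\in D_0\mid\mathit{var}(\delta)\cap\mathit{var}(W)\ne\emptyset\}$, and $\mathcal{D}^*(W)$ is the set of restrictions. Consequence relations w.r.t. $(D_0,V)\in\mathcal{D}(W)$ with set of extensions $\mathcal{E}$: $\Pi_S=\{c(\delta)\mid\delta\in D_0,\neg j(\delta)\notin S\}$; $W\vdash_c\varphi$ iff $\varphi\in\bigcup_{E\in\mathcal{E}}\mathit{Cn}(V\cup\Pi_E)$; $W\vdash_s\varphi$ iff $\varphi\in\bigcap_{E\in\mathcal{E}}\mathit{Cn}(V\cup\Pi_E)$; $W\vdash_p\varphi$ iff $\varphi\in\mathit{Cn}(V\cup\bigcap_{E\in\mathcal{E}}\Pi_E)$. QBFs with usual semantics ($\models$ = valid). For $T_0$ finite and $S_0$ a finite set of formulas $\psi_k$ each with selector $g_k$: $\mathcal{C}[T_0,S_0]=\exists P(T_0\wedge\bigwedge_{\psi_k\in S_0}(g_k\to\psi_k))$, $P$ the non-selector atoms of $T_0\cup S_0$. $\mathit{Ext}[T]=\mathcal{C}[V,j(D)]\wedge\bigwedge_{i=1}^n(\neg g_i\to\neg\mathcal{C}[V\cup\{j(\delta_i)\},j(D\setminus\{\delta_i\})])$ ($j(\delta_k)$ indexed by $g_k$); $\mathit{Conseq}[T,\chi]=\forall P(V\wedge\bigwedge_{i=1}^n(g_i\to c(\delta_i))\to\chi)$, $P$ the atoms occurring in $T$ or $\chi$.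
   Formalization: Formulas of L_Σ are built from atoms without the constants ⊤ and ⊥ (⊤ in the defaults is the tautology p→p): with constants, W={⊥} has inconsistent W^±, so W ⊢_c φ for all φ while Ext[T] is unsatisfiable, and (1) fails. *)

(* Defs.v *)
From HB Require Import structures.
From mathcomp Require Import all_boot.
From mathcomp Require Import boolp classical_sets.

Set Implicit Arguments.
Unset Strict Implicit.
Unset Printing Implicit Defensive.

Local Open Scope classical_set_scope.

(** * Propositional logic *)

(* There are no primitive truth constants: with a primitive constant false one
   could take W = {false}, whose signed form is inconsistent, whereas the
   signed form of a constant-free W is always consistent. The equivalence is an
   abbreviation, so that every atom occurrence has exactly one polarity. *)
Inductive form (A : Type) : Type :=
| Var of A
| Neg of form A
| And of form A & form A
| Or of form A & form A
| Imp of form A & form A.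

Definition Iff (A : Type) (a b : form A) : form A := And (Imp a b) (Imp b a).

Definition Taut (A : Type) (p : A) : form A := Imp (Var p) (Var p).

Section FormEq.
Variable A : Type.

Fixpoint form_encode (a : form A) : GenTree.tree A :=
  match a with
  | Var p => GenTree.Leaf p
  | Neg b => GenTree.Node 0 [:: form_encode b]
  | And b c => GenTree.Node 1 [:: form_encode b; form_encode c]
  | Or b c => GenTree.Node 2 [:: form_encode b; form_encode c]
  | Imp b c => GenTree.Node 3 [:: form_encode b; form_encode c]
  end.

Fixpoint form_decode (t : GenTree.tree A) : option (form A) :=
  match t with
  | GenTree.Leaf p => Some (Var p)
  | GenTree.Node 0 [:: t1] => omap (@Neg A) (form_decode t1)
  | GenTree.Node 1 [:: t1; t2] =>
      obind (fun b => omap (And b) (form_decode t2)) (form_decode t1)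
  | GenTree.Node 2 [:: t1; t2] =>
      obind (fun b => omap (Or b) (form_decode t2)) (form_decode t1)
  | GenTree.Node 3 [:: t1; t2] =>
      obind (fun b => omap (Imp b) (form_decode t2)) (form_decode t1)
  | _ => None
  end.

Lemma form_encodeK : pcancel form_encode form_decode.
Proof. by elim=> //= [a ->|a -> b ->|a -> b ->|a -> b ->]. Qed.

End FormEq.

HB.instance Definition _ (A : eqType) :=
  Equality.copy (form A) (pcan_type (@form_encodeK A)).

Fixpoint map_form (A B : Type) (f : A -> B) (a : form A) : form B :=
  match a with
  | Var p => Var (f p)
  | Neg b => Neg (map_form f b)
  | And b c => And (map_form f b) (map_form f c)
  | Or b c => Or (map_form f b) (map_form f c)
  | Imp b c => Imp (map_form f b) (map_form f c)
  end.

Fixpoint fvars (A : Type) (a : form A) : seq A :=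
  match a with
  | Var p => [:: p]
  | Neg b => fvars b
  | And b c | Or b c | Imp b c => fvars b ++ fvars c
  end.

Fixpoint feval (A : Type) (v : A -> bool) (a : form A) : bool :=
  match a with
  | Var p => v p
  | Neg b => ~~ feval v b
  | And b c => feval v b && feval v c
  | Or b c => feval v b || feval v c
  | Imp b c => feval v b ==> feval v c
  end.

Definition Cn (A : Type) (S : set (form A)) : set (form A) :=
  [set a | forall v : A -> bool, (forall b, S b -> feval v b) -> feval v a].

(** * Occurrences and polarity *)

(* A position is the path from the root of the formula ([false]: left or only
   subformula, [true]: right subformula); polarity [true] is positive. *)
Definition position := seq bool.

Fixpoint occs_rec (A : Type) (pi : position) (s : bool) (a : form A) :
    seq (position * bool * A) :=
  match a with
  | Var p => [:: (pi, s, p)]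
  | Neg b => occs_rec (rcons pi false) (~~ s) b
  | And b c | Or b c =>
      occs_rec (rcons pi false) s b ++ occs_rec (rcons pi true) s c
  | Imp b c =>
      occs_rec (rcons pi false) (~~ s) b ++ occs_rec (rcons pi true) s c
  end.

Definition occs (A : Type) (a : form A) := occs_rec [::] true a.

Fixpoint replace_rec (A B : Type) (f : position -> bool -> A -> form B)
    (pi : position) (s : bool) (a : form A) : form B :=
  match a with
  | Var p => f pi s p
  | Neg b => Neg (replace_rec f (rcons pi false) (~~ s) b)
  | And b c => And (replace_rec f (rcons pi false) s b)
                   (replace_rec f (rcons pi true) s c)
  | Or b c => Or (replace_rec f (rcons pi false) s b)
                 (replace_rec f (rcons pi true) s c)
  | Imp b c => Imp (replace_rec f (rcons pi false) (~~ s) b)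
                   (replace_rec f (rcons pi true) s c)
  end.

Definition replace_occs (A B : Type) (f : position -> bool -> A -> form B)
    (a : form A) : form B := replace_rec f [::] true a.

(** * Signed alphabet *)

Inductive satom (Sigma : Type) : Type :=
| Orig of Sigma            (* p     *)
| Plus of Sigma            (* p^+   *)
| Minus of Sigma           (* p^-   *)
| PlusI of Sigma & nat     (* p^+_i *)
| MinusI of Sigma & nat.   (* p^-_i *)

Arguments Orig {Sigma}.

Section SatomEq.
Variable Sigma : Type.

Definition satom_encode (x : satom Sigma) : Sigma * option (bool * option nat) :=
  match x with
  | Orig p => (p, None)
  | Plus p => (p, Some (true, None))
  | Minus p => (p, Some (false, None))
  | PlusI p i => (p, Some (true, Some i))
  | MinusI p i => (p, Some (false, Some i))
  end.

Definition satom_decode (x : Sigma * option (bool * option nat)) : satom Sigma :=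
  match x with
  | (p, None) => Orig p
  | (p, Some (true, None)) => Plus p
  | (p, Some (false, None)) => Minus p
  | (p, Some (true, Some i)) => PlusI p i
  | (p, Some (false, Some i)) => MinusI p i
  end.

Lemma satom_encodeK : cancel satom_encode satom_decode.
Proof. by case. Qed.

End SatomEq.

HB.instance Definition _ (Sigma : eqType) :=
  Equality.copy (satom Sigma) (can_type (@satom_encodeK Sigma)).

Definition embed (Sigma : Type) (a : form Sigma) : form (satom Sigma) :=
  map_form Orig a.

(** * Default logic *)

Record default (A : Type) : Type :=
  Default { pre : form A; just : form A; concl : form A }.

(* The set of facts is finite and represented by a list, whose order and
   repetitions are irrelevant; the set of defaults may be infinite. *)
Record theory (A : Type) : Type :=
  Theory { defaults : set (default A); facts : seq (form A) }.

Definition dvars (A : Type) (d : default A) : seq A :=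
  fvars (pre d) ++ fvars (just d) ++ fvars (concl d).

Definition fact_set (A : eqType) (T : theory A) : set (form A) :=
  [set a | a \in facts T].

(* [stage T E n] is the set E_{n+1}, with E_1 = V. *)
Fixpoint stage (A : eqType) (T : theory A) (E : set (form A)) (n : nat) :
    set (form A) :=
  match n with
  | 0 => fact_set T
  | m.+1 => Cn (stage T E m) `|`
      [set concl d | d in
         [set d | [/\ defaults T d, stage T E m (pre d) & ~ E (Neg (just d))]]]
  end.

Definition extensions (A : eqType) (T : theory A) : set (set (form A)) :=
  [set E | E = \bigcup_n stage T E n].

(** * Signed default theories *)

Section Signed.
Variable Sigma : eqType.
Implicit Types (p : Sigma) (W : seq (form Sigma)).
Implicit Types (I : form Sigma * position -> nat).

Definition occurs (s : bool) p W : bool :=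
  has (fun a => has (fun o => (o.1.2 == s) && (o.2 == p)) (occs a)) W.

Definition complementary W p : bool := occurs true p W && occurs false p W.

(* An occurrence of an atom in W is a member of W together with a position in
   that formula. *)
Definition occurrences W : seq (form Sigma * position) :=
  [seq (a, o.1.1) | a <- W, o <- occs a].

Definition indexing W I : Prop := {in occurrences W &, injective I}.

Definition index_of W I (s : bool) p : set nat :=
  [set i | exists a pi, [/\ a \in W, (pi, s, p) \in occs a & I (a, pi) = i]].

Definition signed_lit (s : bool) p : form (satom Sigma) :=
  if s then Var (Plus p) else Neg (Var (Minus p)).

Definition signed_form (a : form Sigma) : form (satom Sigma) :=
  replace_occs (fun _ s p => signed_lit s p) a.

Definition signed_set W : seq (form (satom Sigma)) :=
  [seq signed_form a | a <- W].

Definition signed_formI W I (a : form Sigma) : form (satom Sigma) :=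
  replace_occs (fun pi s p =>
    if complementary W p then
      if s then Var (PlusI p (I (a, pi))) else Neg (Var (MinusI p (I (a, pi))))
    else signed_lit s p) a.

Definition signed_setI W I : seq (form (satom Sigma)) :=
  [seq signed_formI W I a | a <- W].

Definition delta_ p : default (satom Sigma) :=
  Default (Taut (Orig p))
    (Iff (Var (Plus p)) (Neg (Var (Minus p))))
    (And (Iff (Var (Orig p)) (Var (Plus p)))
         (Iff (Neg (Var (Orig p))) (Var (Minus p)))).

Definition D_Sigma : set (default (satom Sigma)) := [set delta_ p | p in setT].

Definition normal_default p (b : form (satom Sigma)) : default (satom Sigma) :=
  Default (Taut (Orig p)) b b.

Definition plus_eq p (i : nat) : form (satom Sigma) :=
  Iff (Var (Orig p)) (Var (PlusI p i)).

Definition minus_eq p (j : nat) : form (satom Sigma) :=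
  Iff (Neg (Var (Orig p))) (Var (MinusI p j)).

Definition D1_Sigma W I : set (default (satom Sigma)) :=
  [set d | exists p, if complementary W p then
             exists i j, [/\ index_of W I true p i, index_of W I false p j
               & d = normal_default p (And (plus_eq p i) (minus_eq p j))]
           else d = delta_ p].

Definition D2_Sigma W I : set (default (satom Sigma)) :=
  [set d | exists p, if complementary W p then
             (exists2 i, index_of W I true p i
                & d = normal_default p (plus_eq p i)) \/
             (exists2 j, index_of W I false p j
                & d = normal_default p (minus_eq p j))
           else d = delta_ p].

Inductive signed_theories W : set (theory (satom Sigma)) :=
| SignedTheory :
    signed_theories W (Theory D_Sigma (signed_set W))
| SignedTheory1 I : indexing W I ->
    signed_theories W (Theory (D1_Sigma W I) (signed_setI W I))
| SignedTheory2 I : indexing W I ->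
    signed_theories W (Theory (D2_Sigma W I) (signed_setI W I)).

Definition restriction W (T0 : theory (satom Sigma)) : theory (satom Sigma) :=
  Theory
    [set d | defaults T0 d /\
       exists p a, [/\ a \in W, p \in fvars a & Orig p \in dvars d]]
    (facts T0).

(** ** Unsigned consequence relations *)

Definition Pi (T0 : theory (satom Sigma)) (S : set (form (satom Sigma))) :
    set (form (satom Sigma)) :=
  [set concl d | d in [set d | defaults T0 d /\ ~ S (Neg (just d))]].

Definition credulous (T0 : theory (satom Sigma)) (phi : form Sigma) : Prop :=
  (\bigcup_(E in extensions T0) Cn (fact_set T0 `|` Pi T0 E)) (embed phi).

Definition skeptical (T0 : theory (satom Sigma)) (phi : form Sigma) : Prop :=
  (\bigcap_(E in extensions T0) Cn (fact_set T0 `|` Pi T0 E)) (embed phi).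

Definition prudent (T0 : theory (satom Sigma)) (phi : form Sigma) : Prop :=
  Cn (fact_set T0 `|` \bigcap_(E in extensions T0) Pi T0 E) (embed phi).

End Signed.

(** * Quantified Boolean formulas *)

Inductive qbf (X : Type) : Type :=
| QTrue
| QVar of X
| QNeg of qbf X
| QAnd of qbf X & qbf X
| QOr of qbf X & qbf X
| QImp of qbf X & qbf X
| QEx of X & qbf X
| QAll of X & qbf X.

Arguments QTrue {X}.

Fixpoint qeval (X : eqType) (v : X -> bool) (q : qbf X) : bool :=
  match q with
  | QTrue => true
  | QVar x => v x
  | QNeg r => ~~ qeval v r
  | QAnd r t => qeval v r && qeval v t
  | QOr r t => qeval v r || qeval v t
  | QImp r t => qeval v r ==> qeval v t
  | QEx x r => qeval [eta v with x |-> true] r || qeval [eta v with x |-> false] r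
  | QAll x r => qeval [eta v with x |-> true] r && qeval [eta v with x |-> false] r
  end.

Definition valid (X : eqType) (q : qbf X) : Prop := forall v, qeval v q.

Definition QExs (X : Type) (xs : seq X) (q : qbf X) : qbf X := foldr (@QEx X) q xs.
Definition QAlls (X : Type) (xs : seq X) (q : qbf X) : qbf X := foldr (@QAll X) q xs.
Definition QConj (X : Type) (qs : seq (qbf X)) : qbf X := foldr (@QAnd X) QTrue qs.

(* Every occurrence of a variable is replaced, including in quantifiers. *)
Fixpoint qrename (X Y : Type) (f : X -> Y) (q : qbf X) : qbf Y :=
  match q with
  | QTrue => QTrue
  | QVar x => QVar (f x)
  | QNeg r => QNeg (qrename f r)
  | QAnd r t => QAnd (qrename f r) (qrename f t)
  | QOr r t => QOr (qrename f r) (qrename f t)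
  | QImp r t => QImp (qrename f r) (qrename f t)
  | QEx x r => QEx (f x) (qrename f r)
  | QAll x r => QAll (f x) (qrename f r)
  end.

(** * Encodings *)

Inductive qatom (A : Type) : Type :=
| Atom of A
| Sel of nat      (* g_i  *)
| Sel' of nat.    (* g'_i *)

Arguments Sel {A}.
Arguments Sel' {A}.

Section QatomEq.
Variable A : Type.

Definition qatom_encode (x : qatom A) : A + (nat + nat) :=
  match x with
  | Atom a => inl a
  | Sel i => inr (inl i)
  | Sel' i => inr (inr i)
  end.

Definition qatom_decode (x : A + (nat + nat)) : qatom A :=
  match x with
  | inl a => Atom a
  | inr (inl i) => Sel i
  | inr (inr i) => Sel' i
  end.

Lemma qatom_encodeK : cancel qatom_encode qatom_decode.
Proof. by case. Qed.

End QatomEq.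

HB.instance Definition _ (A : eqType) :=
  Equality.copy (qatom A) (can_type (@qatom_encodeK A)).

Section Encoding.
Variable A : eqType.

Fixpoint qform (a : form A) : qbf (qatom A) :=
  match a with
  | Var p => QVar (Atom p)
  | Neg b => QNeg (qform b)
  | And b c => QAnd (qform b) (qform c)
  | Or b c => QOr (qform b) (qform c)
  | Imp b c => QImp (qform b) (qform c)
  end.

Definition seq_vars (V : seq (form A)) : seq A := flatten [seq fvars a | a <- V].

(* S pairs each formula with the index of its selector. *)
Definition Compat (T : seq (form A)) (S : seq (nat * form A)) : qbf (qatom A) :=
  QExs [seq Atom x | x <- undup (seq_vars T ++ seq_vars (unzip2 S))]
    (QAnd (QConj [seq qform a | a <- T])
          (QConj [seq QImp (QVar (Sel s.1)) (qform s.2) | s <- S])).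

Section FixTheory.
Variables (n : nat) (delta : 'I_n -> default A) (V : seq (form A)).

Definition Ext : qbf (qatom A) :=
  QAnd (Compat V [seq (nat_of_ord k, just (delta k)) | k <- enum 'I_n])
    (QConj [seq QImp (QNeg (QVar (Sel i)))
                  (QNeg (Compat (just (delta i) :: V)
                     [seq (nat_of_ord k, just (delta k))
                     | k <- enum 'I_n & k != i]))
           | i : 'I_n <- enum 'I_n]).

Definition Conseq (chi : form A) : qbf (qatom A) :=
  QAlls [seq Atom x | x <- undup (seq_vars V
             ++ flatten [seq dvars (delta i) | i <- enum 'I_n] ++ fvars chi)]
    (QImp (QAnd (QConj [seq qform a | a <- V])
                (QConj [seq QImp (QVar (Sel i)) (qform (concl (delta i)))
                       | i : 'I_n <- enum 'I_n]))
          (qform chi)).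

Definition prime_sel (x : qatom A) : qatom A :=
  if x is Sel i then Sel' i else x.

Definition Conseq' (chi : form A) : qbf (qatom A) :=
  qrename prime_sel (Conseq chi).

Definition G : seq (qatom A) := [seq Sel i | i <- iota 0 n].
Definition G' : seq (qatom A) := [seq Sel' i | i <- iota 0 n].

Definition Psi : qbf (qatom A) :=
  QConj [seq QImp (QNeg (QVar (Sel' i)))
               (QExs G (QAnd Ext (QNeg (Conseq (concl (delta i))))))
        | i : 'I_n <- enum 'I_n].

End FixTheory.

End Encoding.

Arguments G {A} n.
Arguments G' {A} n.

(* Main.v *)
Require Import Defs.
From mathcomp Require Import all_boot.
From mathcomp Require Import boolp classical_sets.

(** Since the prerequisites are tautologies, [E] is an extension of [(D0, V)]
    iff [E = Cn (V u Pi_E)]. Every conclusion entails its justification, and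
    conversely a model of [V] and of some justifications becomes a model of [V]
    and of the corresponding conclusions by setting [p := p^+] for every [p]
    governed by [delta_p], as [p] occurs neither in [V] nor in another
    justification. The defaults removed by the restriction concern atoms outside
    [W]; all of them apply in every extension, and they are satisfied by choosing
    [p^+], [p^-] according to [p], which affects nothing else. Hence extensions
    correspond to the subsets of [D] whose justifications are maximally
    consistent with [V], which is what [Ext] expresses about the selectors. Such
    subsets exist because the signed facts are consistent (make all signed atoms
    true). For prudent consequence, a conclusion that is entailed by [E] is in
    [Pi_E] (its justification is then not refuted), so [Psi] says that [G']
    contains the selectors of all conclusions common to the [Pi_E]. *)

Set Implicit Arguments.
Unset Strict Implicit.
Unset Printing Implicit Defensive.

(** * Semantics of formulas and quantifier blocks *)

Lemma eq_in_feval (A : eqType) (v w : A -> bool) (a : form A) :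
  {in fvars a, v =1 w} -> feval v a = feval w a.
Proof.
elim: a => /= [p|b IHb|b IHb c IHc|b IHb c IHc|b IHb c IHc] vw.
- by apply: vw; rewrite mem_head.
- by rewrite IHb.
all: by rewrite IHb ?IHc // => x xa; apply: vw; rewrite mem_cat xa ?orbT.
Qed.

Section QbfSemantics.
Variable X : eqType.
Implicit Types (v w : X -> bool) (q : qbf X).

Lemma qeval_QExsP v xs q :
  reflect (exists2 w, {in predC (mem xs), w =1 v} & qeval w q)
          (qeval v (QExs xs q)).
Proof.
elim: xs v => [|x xs IHxs] v /=.
  apply: (iffP idP) => [vq|[w wv]]; first by exists v.
  by have -> : w = v by apply: funext => y; apply: wv.
apply: (iffP orP).
  move=> vq; have [b /IHxs[w wv wq]] :
      exists b, qeval [eta v with x |-> b] (QExs xs q).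
    by case: vq => ?; [exists true | exists false].
  exists w => // y; rewrite !inE negb_or => /andP[yx yxs].
  by rewrite wv ?inE //= (negbTE yx).
case=> w wv wq; have : qeval [eta v with x |-> w x] (QExs xs q).
  apply/IHxs; exists w => // y; rewrite inE => yxs /=.
  by case: eqVneq => [->//|yx]; rewrite wv // !inE negb_or yx.
by case: (w x) => ?; [left | right].
Qed.

Lemma qeval_QAlls v xs q :
  qeval v (QAlls xs q) = ~~ qeval v (QExs xs (QNeg q)).
Proof.
elim: xs v => [|x xs IHxs] v /=; first by rewrite negbK.
by rewrite !IHxs negb_or.
Qed.

Lemma qeval_QConj v qs : qeval v (QConj qs) = all (qeval v) qs.
Proof. by elim: qs => //= q qs ->. Qed.

Lemma qeval_QAnd v q r : qeval v (QAnd q r) <-> qeval v q /\ qeval v r.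
Proof. by split=> /andP. Qed.

Lemma qeval_QNeg v q : qeval v (QNeg q) <-> ~ qeval v q.
Proof. by split=> /negP. Qed.

(** Meant for formulas whose truth value does not depend on the valuation. *)
Lemma valid_const q P : (forall v, qeval v q <-> P) -> valid q <-> P.
Proof. by move=> qP; split=> [/(_ xpred0)/qP//|p v]; apply/qP. Qed.

End QbfSemantics.

Lemma qrename_QAlls (X Y : Type) (f : X -> Y) xs (q : qbf X) :
  qrename f (QAlls xs q) = QAlls [seq f x | x <- xs] (qrename f q).
Proof. by elim: xs => //= x xs ->. Qed.

Lemma qrename_QConj (X Y : Type) (f : X -> Y) (qs : seq (qbf X)) :
  qrename f (QConj qs) = QConj [seq qrename f q | q <- qs].
Proof. by elim: qs => //= q qs ->. Qed.

(** * Meaning of the encodings in terms of sets of selected defaults *)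

Section EncodingSemantics.
Variable A : eqType.
Implicit Types (v w : qatom A -> bool) (u : A -> bool) (V : seq (form A)).

Lemma qeval_qform v a : qeval v (qform a) = feval (v \o @Atom A) a.
Proof. by elim: a => //= [b ->|b -> c ->|b -> c ->|b -> c ->]. Qed.

Lemma qrename_qform (a : form A) : qrename (@prime_sel A) (qform a) = qform a.
Proof. by elim: a => //= [b ->|b -> c ->|b -> c ->|b -> c ->]. Qed.

Lemma fvars_seq_vars V a : a \in V -> {subset fvars a <= seq_vars V}.
Proof. by move=> aV x xa; apply/flattenP; exists (fvars a) => //; apply: map_f. Qed.

(** The witness for blocks of atom quantifiers: bound atoms take their values from [u], selectors
    keep theirs from [v]. *)
Definition overwrite (xs : seq A) u v (x : qatom A) : bool :=
  if x is Atom a then if a \in xs then u a else v x else v x.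

Lemma overwriteN xs u v :
  {in predC (mem [seq Atom x | x <- undup xs]), overwrite xs u v =1 v}.
Proof.
case=> //= a; rewrite !inE mem_map => [|x y []//].
by rewrite mem_undup => /negbTE->.
Qed.

Lemma qeval_overwrite xs u v a :
  {subset fvars a <= xs} -> qeval (overwrite xs u v) (qform a) = feval u a.
Proof.
by move=> axs; rewrite qeval_qform; apply: eq_in_feval => x /axs /= ->.
Qed.

Lemma qeval_Compat v V S :
  qeval v (Compat V S) <->
  exists2 u, all (feval u) V & forall s, s \in S -> v (Sel s.1) -> feval u s.2.
Proof.
split=> [/qeval_QExsP[w wv]|[u uV uS]].
  rewrite /= !qeval_QConj !all_map => /andP[/allP wV /allP wS].
  exists (w \o @Atom A) => [|s sS vs].
    by apply/allP => a /wV /=; rewrite qeval_qform.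
  move/(_ _ sS): wS => /=; rewrite qeval_qform wv ?vs // inE.
  by apply/mapP => -[].
apply/qeval_QExsP; eexists; first exact: (@overwriteN _ u).
rewrite /= !qeval_QConj !all_map; apply/andP; split; apply/allP => s sS /=.
  rewrite qeval_overwrite ?(allP uV) // => x xs.
  by rewrite mem_cat (fvars_seq_vars sS).
rewrite qeval_overwrite => [|x xs]; first exact/implyP/uS.
by rewrite mem_cat (fvars_seq_vars (map_f _ sS) xs) orbT.
Qed.

Section FixTheory.
Variables (n : nat) (delta : 'I_n -> default A) (V : seq (form A)).
Implicit Types (g : 'I_n -> bool).

Definition just_model g u :=
  all (feval u) V /\ forall k, g k -> feval u (just (delta k)).

Definition concl_model g u :=
  all (feval u) V /\ forall k, g k -> feval u (concl (delta k)).

(** Refuting unselected justifications one at a time suffices for maximality, since consistency is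
    inherited by smaller selections. *)
Definition maximal_selection g :=
  (exists u, just_model g u) /\
  forall i u, ~~ g i -> just_model g u -> ~~ feval u (just (delta i)).

Definition selection_entails g chi := forall u, concl_model g u -> feval u chi.

Lemma qeval_Ext v :
  qeval v (Ext delta V) <-> maximal_selection (fun i => v (Sel i)).
Proof.
rewrite /Ext /= qeval_QConj all_map; split.
  move=> /andP[/qeval_Compat[u uV uS] /allP vmax]; split.
    by exists u; split=> // k vk; apply: (uS (nat_of_ord k, just (delta k))) => //;
      apply/mapP; exists k; rewrite ?mem_enum.
  move=> i w vi [wV wS]; apply/negP => wi.
  move/(_ i (mem_enum _ _)): vmax => /=; rewrite vi /= => /negP; apply.
  apply/qeval_Compat; exists w; first by rewrite /= wi.
  by move=> _ /mapP[k _ ->] /= /wS.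
move=> [[u [uV uS]] vmax]; apply/andP; split.
  by apply/qeval_Compat; exists u => // _ /mapP[k _ ->] /= /uS.
apply/allP => i _ /=; apply/implyP => vi; apply/negP.
move=> /qeval_Compat[w /= /andP[wi wV] wS].
suff wg : just_model (fun k => v (Sel k)) w by have /negP[] := vmax i w vi wg.
split=> // k vk.
apply: (wS (nat_of_ord k, just (delta k))) => //; apply/mapP; exists k => //.
rewrite mem_filter mem_enum andbT.
(* A selected [k] differs from the unselected [i], so leaving [i] out of the list loses no
   constraint. *)
by apply: contraNneq vi => <-.
Qed.

(** Stated for arbitrary selectors so that it covers the [Sel i] and, after renaming, the
    [Sel' i]. *)
Lemma qeval_Conseq_sel (sel : nat -> qatom A) v chi :
  (forall i a, sel i <> Atom a) ->
  qeval v (QAlls [seq Atom x | x <- undup (seq_vars V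
             ++ flatten [seq dvars (delta i) | i <- enum 'I_n] ++ fvars chi)]
    (QImp (QAnd (QConj [seq qform a | a <- V])
                (QConj [seq QImp (QVar (sel i)) (qform (concl (delta i)))
                       | i : 'I_n <- enum 'I_n]))
          (qform chi))) <->
  selection_entails (fun i => v (sel i)) chi.
Proof.
move=> selA; rewrite qeval_QAlls; set xs := _ ++ _; split.
  move=> vN u [uV uS]; apply: contraNT vN => uchi.
  apply/qeval_QExsP; eexists; first exact: (@overwriteN _ u).
  rewrite /= negb_imply !qeval_QConj 2!all_map qeval_overwrite => [|x xc].
    rewrite uchi andbT; apply/andP; split; apply/allP => a aV /=.
      rewrite qeval_overwrite ?(allP uV) // => x xa.
      by rewrite mem_cat (fvars_seq_vars aV).
    rewrite qeval_overwrite => [|x xa].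
      apply/implyP; rewrite /overwrite; case E: (sel a) => [b||]; last first.
      - by rewrite -E => /uS.
      - by rewrite -E => /uS.
      by case: (selA _ _ E).
    rewrite !mem_cat; apply/orP; right; apply/orP; left.
    apply/flattenP; exists (dvars (delta a)).
      by apply/mapP; exists a; rewrite ?mem_enum.
    by rewrite !mem_cat xa !orbT.
  by rewrite !mem_cat xc !orbT.
move=> vchi; apply/negP => /qeval_QExsP[w wv] /=.
rewrite negb_imply !qeval_QConj 2!all_map qeval_qform.
case/andP=> /andP[/allP wV /allP wS] /negP[]; apply: vchi; split.
  by apply/allP => a /wV /=; rewrite qeval_qform.
move=> k vk; move/(_ k (mem_enum _ _)): wS => /=; rewrite qeval_qform wv ?vk //.
by rewrite inE; apply/mapP => -[x _ /selA].
Qed.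

Lemma qeval_Conseq v chi :
  qeval v (Conseq delta V chi) <-> selection_entails (fun i => v (Sel i)) chi.
Proof. exact: qeval_Conseq_sel. Qed.

Lemma qeval_Conseq' v chi :
  qeval v (Conseq' delta V chi) <-> selection_entails (fun i => v (Sel' i)) chi.
Proof.
rewrite -(@qeval_Conseq_sel Sel') // /Conseq' qrename_QAlls /= !qrename_QConj.
rewrite qrename_qform -map_comp -(map_comp (qrename _) (@qform A)).
rewrite (eq_map (g := @qform A)) => [|a /=]; last exact: qrename_qform.
rewrite -(map_comp (qrename _)) (eq_map (g := fun i : 'I_n =>
  QImp (QVar (Sel' i)) (qform (concl (delta i))))) // => i /=.
by rewrite qrename_qform.
Qed.

Lemma qeval_QExs_sel (sel : nat -> qatom A) q P v : injective sel ->
  (forall w, qeval w q <-> P (fun i : 'I_n => w (sel i))) ->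
  qeval v (QExs [seq sel i | i <- iota 0 n] q) <-> exists g, P g.
Proof.
move=> sel_inj qP; split=> [/qeval_QExsP[w _ /qP]|[g Pg]]; first by eexists; eauto.
(* Inverts [sel] to read the values off [g]; elsewhere [w] falls back on [v]. *)
pose w x := if [pick i : 'I_n | sel i == x] is Some i then g i else v x.
apply/qeval_QExsP; exists w => [x|].
  rewrite inE /w => xG; case: pickP => // i /eqP ix.
  by case/mapP: xG; exists (nat_of_ord i); rewrite ?mem_iota ?ltn_ord.
apply/qP; suff -> : (fun i : 'I_n => w (sel i)) = g by [].
apply: funext => i; rewrite /w; case: pickP => [j /eqP/sel_inj/val_inj->//|].
by move/(_ i); rewrite eqxx.
Qed.

Lemma qeval_QExsG q P v :
  (forall w, qeval w q <-> P (fun i : 'I_n => w (Sel i))) ->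
  qeval v (QExs (G n) q) <-> exists g, P g.
Proof. by apply: qeval_QExs_sel => i j []. Qed.

Lemma qeval_QExsG' q P v :
  (forall w, qeval w q <-> P (fun i : 'I_n => w (Sel' i))) ->
  qeval v (QExs (G' n) q) <-> exists g, P g.
Proof. by apply: qeval_QExs_sel => i j []. Qed.

Lemma qeval_Psi v :
  qeval v (Psi delta V) <->
  forall i : 'I_n, ~~ v (Sel' i) -> exists g, maximal_selection g /\
    ~ selection_entails g (concl (delta i)).
Proof.
have exP (i : 'I_n) : qeval v (QExs (G n) (QAnd (Ext delta V)
      (QNeg (Conseq delta V (concl (delta i)))))) <->
    exists g, maximal_selection g /\ ~ selection_entails g (concl (delta i)).
  apply: (qeval_QExsG (P := fun g => maximal_selection g /\ _)) => w.
  by rewrite qeval_QAnd qeval_QNeg qeval_Ext qeval_Conseq.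
rewrite /Psi qeval_QConj all_map; split=> [/allP vP i vi|vP].
  by apply/exP; move/(_ i (mem_enum _ _)): vP => /=; rewrite vi.
by apply/allP => i _ /=; apply/implyP => /vP/exP.
Qed.

Lemma valid_credulous chi :
  valid (QExs (G n) (QAnd (Ext delta V) (Conseq delta V chi))) <->
  exists g, maximal_selection g /\ selection_entails g chi.
Proof.
apply: valid_const => v.
apply: (qeval_QExsG (P := fun g => maximal_selection g /\ _)) => w.
by rewrite qeval_QAnd qeval_Ext qeval_Conseq.
Qed.

Lemma valid_skeptical chi :
  valid (QNeg (QExs (G n) (QAnd (Ext delta V) (QNeg (Conseq delta V chi))))) <->
  forall g, maximal_selection g -> selection_entails g chi.
Proof.
apply: valid_const => v.
have exP := @qeval_QExsG (QAnd (Ext delta V) (QNeg (Conseq delta V chi)))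
  (fun g => maximal_selection g /\ ~ selection_entails g chi) v.
rewrite qeval_QNeg exP => [|w]; first split=> [gN g gmax|gP [g [/gP]]] //.
  by apply: contrapT => gchi; apply: gN; exists g.
by rewrite qeval_QAnd qeval_QNeg qeval_Ext qeval_Conseq.
Qed.

Lemma valid_prudent chi :
  valid (QNeg (QExs (G' n) (QAnd (QNeg (Conseq' delta V chi)) (Psi delta V)))) <->
  forall g', (forall i, ~~ g' i -> exists g, maximal_selection g /\
                ~ selection_entails g (concl (delta i))) ->
    selection_entails g' chi.
Proof.
apply: valid_const => v.
have exP := @qeval_QExsG' (QAnd (QNeg (Conseq' delta V chi)) (Psi delta V))
  (fun g' => ~ selection_entails g' chi /\
     forall i, ~~ g' i -> exists g, maximal_selection g /\
       ~ selection_entails g (concl (delta i))) v.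
rewrite qeval_QNeg exP => [|w]; first split=> [gN g gmax|gP [g [gchi /gP]]] //.
  by apply: contrapT => gchi; apply: gN; exists g.
by rewrite qeval_QAnd qeval_QNeg qeval_Psi qeval_Conseq'.
Qed.

End FixTheory.

End EncodingSemantics.

(** Greedy extension of the empty selection: as long as maximality fails, some unselected
    justification holds in a model of the selected ones, and its index is added. The number of
    unselected indices drops each time. *)
Lemma maximal_selection_exists (A : eqType) n (delta : 'I_n -> default A)
    (V : seq (form A)) (u : A -> bool) :
  all (feval u) V -> exists g, maximal_selection delta V g.
Proof.
move=> uV; have : exists w, just_model delta V xpred0 w by exists u.
move: xpred0 => g; move: {2}_.+1 (ltnSn #|[pred i | ~~ g i]|) => m.
elim: m g => // m IHm g gm gV.
have [gmax|] := pselect (maximal_selection delta V g); first by exists g.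
move=> /not_andP[//|/existsNP[i /existsNP[w /not_implyP[gi]]]].
move=> /not_implyP[[wV wg] /negP/negbNE wi].
apply: (IHm [pred k | (k == i) || g k]); last first.
  by exists w; split=> // k /orP[/eqP->|/wg].
rewrite ltnS in gm; apply: leq_trans gm; apply: proper_card; apply/properP; split.
  by apply/fintype.subsetP => k; rewrite !inE negb_or => /andP[].
by exists i; rewrite !inE ?eqxx.
Qed.

(** * Extensions versus maximal selections when prerequisites are tautologies *)

Section PrerequisiteFree.
Local Open Scope classical_set_scope.

Variables (Sigma : eqType) (T0 : theory (satom Sigma)).
Variables (n : nat) (delta : 'I_n -> default (satom Sigma)).
Local Notation V := (facts T0).
Local Notation D := (defaults T0).
Implicit Types (v u : satom Sigma -> bool) (g : 'I_n -> bool).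

Hypothesis pre_valid : forall d v, D d -> feval v (pre d).
Hypothesis concl_just : forall d v, D d -> feval v (concl d) -> feval v (just d).
Hypothesis delta_defaults : forall i, D (delta i).
Hypothesis facts_consistent : exists v, all (feval v) V.

(* [settle] turns a model of the justifications into one of the conclusions;
   [complete] makes the conclusions of all defaults outside [delta] true. *)
Variables settle complete : (satom Sigma -> bool) -> satom Sigma -> bool.
Hypothesis settle_facts : forall v, all (feval v) V -> all (feval (settle v)) V.
Hypothesis settle_concl : forall d v, D d ->
  feval v (just d) -> feval (settle v) (concl d).
Hypothesis complete_facts : forall v,
  all (feval v) V -> all (feval (complete v)) V.
Hypothesis complete_concl : forall i v,
  feval (complete v) (concl (delta i)) = feval v (concl (delta i)).
Hypothesis complete_other : forall d v, D d ->
  (exists i, delta i = d) \/ feval (complete v) (concl d).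

Local Notation max_sel := (maximal_selection delta V).
Local Notation entails := (selection_entails delta V).

Lemma extensionP E : extensions T0 E <-> E = Cn (fact_set T0 `|` Pi T0 E).
Proof.
suff stages : \bigcup_k stage T0 E k = Cn (fact_set T0 `|` Pi T0 E).
  by rewrite /extensions /= stages.
apply/seteqP; split=> [a [k _]|a Ea].
  elim: k a => [|k IHk] a /=; first by move=> aV v; apply; left.
  move=> [ka v vV|[d [dD _ dE] <-] v]; last by apply; right; exists d.
  by apply: ka => b /IHk; apply.
(* Stage 1 contains the prerequisites, stage 2 the conclusions of the unrefuted defaults, stage 3
   all that these and the facts entail. *)
exists 3%N => //=; left => v v2; apply: Ea => b [bV|[d [dD dE] <-]].
  apply: v2; left => w w1; apply: w1; left => u u0; exact: u0.
apply: v2; right; exists d => //; split=> //.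
by left => u _; apply: pre_valid.
Qed.

(** Defaults outside the range of [delta] always count as selected, because they apply in every
    extension. *)
Definition selected g : set (default (satom Sigma)) :=
  [set d | D d /\ ((exists2 i, delta i = d & g i) \/ ~ exists i, delta i = d)].

Definition selected_concls g := [set concl d | d in selected g].

Lemma concl_model_complete g u : concl_model delta V g u ->
  forall b, (fact_set T0 `|` selected_concls g) b -> feval (complete u) b.
Proof.
move=> [uV uC] b [bV|[d [dD [[i <- gi]|dN]] <-]].
- exact: (allP (complete_facts uV)).
- by rewrite complete_concl uC.
- by case: (complete_other u dD).
Qed.

Lemma selected_concl_model g u :
  (forall b, (fact_set T0 `|` selected_concls g) b -> feval u b) ->
  concl_model delta V g u.
Proof.
move=> uP; split=> [|k gk]; first by apply/allP => a aV; apply: uP; left.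
apply: uP; right; exists (delta k) => //; split=> //; by left; exists k.
Qed.

Lemma just_model_settle g u :
  just_model delta V g u -> concl_model delta V g (settle u).
Proof.
by move=> [uV uJ]; split=> [|k /uJ]; [exact: settle_facts | exact: settle_concl].
Qed.

Lemma concl_just_model g u : concl_model delta V g u -> just_model delta V g u.
Proof. by move=> [uV uC]; split=> // k /uC; apply: concl_just. Qed.

Lemma Cn_selected g chi : (forall v, feval (complete v) chi = feval v chi) ->
  Cn (fact_set T0 `|` selected_concls g) chi <-> entails g chi.
Proof.
move=> chi_id; split=> [gchi u ug|gchi u /selected_concl_model]; last exact: gchi.
by rewrite -chi_id; apply/gchi/concl_model_complete.
Qed.

(** The extension is the closure of the facts and the selected conclusions. It has the model
    [complete (settle u)], so selected justifications are not refuted; maximality refutes the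
    unselected ones. *)
Lemma max_sel_extension g : max_sel g ->
  exists2 E, extensions T0 E & Pi T0 E = selected_concls g.
Proof.
move=> [[u ug] gmax]; set S := fact_set T0 `|` selected_concls g.
have [w wS] : exists w, forall b, S b -> feval w b.
  by eexists; apply/concl_model_complete/just_model_settle/ug.
have PiS : Pi T0 (Cn S) = selected_concls g.
  apply/seteqP; split=> [_ [d [dD dN] <-]|_ [d [dD dS] <-]]; last first.
    exists d => //; split=> // /(_ w wS) /= /negP; apply.
    by apply: concl_just => //; apply: wS; right; exists d.
  exists d => //; split=> //; have [[i di]|] := pselect (exists i, delta i = d).
    left; exists i => //; apply: contrapT => /negP gi; apply: dN => v vS /=.
    by rewrite -di; apply: gmax gi _; apply/concl_just_model/selected_concl_model.
  by right.
by exists (Cn S) => //; apply/extensionP; rewrite PiS.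
Qed.

Lemma extension_max_sel E : extensions T0 E ->
  exists2 g, max_sel g & Pi T0 E = selected_concls g.
Proof.
move/extensionP => EE.
(* If the generators of [E] had no model, [E] would contain all formulas, no default would apply,
   and only the consistent facts would remain. *)
have [w wE] : exists w, forall b, (fact_set T0 `|` Pi T0 E) b -> feval w b.
  apply: contrapT => noW; have Eall a : E a.
    by rewrite EE => v vE; case: noW; exists v.
  case: facts_consistent => v vV; apply: noW; exists v => b [/(allP vV)//|].
  by move=> [d [_ []]].
have cwE : forall b, (fact_set T0 `|` Pi T0 E) b -> feval (complete w) b.
  move=> b [bV|bP].
    apply: (allP _ _ bV); apply: complete_facts; apply/allP => a aV.
    by apply: wE; left.
  case: (bP) => d [dD _] db; case: (complete_other w dD) => [[i di]|]; last by rewrite db.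
  by rewrite -db -di complete_concl di db; apply: wE; right.
pose g i := `[< ~ E (Neg (just (delta i))) >].
have PiE : Pi T0 E = selected_concls g.
  apply/seteqP; split=> [_ [d [dD dE] <-]|_ [d [dD dS] <-]].
    exists d => //; split=> //; have [[i di]|] := pselect (exists i, delta i = d).
      by left; exists i => //; apply/asboolP; rewrite di.
    by right.
  exists d => //; split=> //; case: dS => [[i <- /asboolP//]|dN].
  (* A default outside [delta] is not refuted: [complete w] models [E] and satisfies its conclusion,
     hence its justification. *)
  rewrite EE => /(_ _ cwE) /= /negP; apply; apply: concl_just => //.
  by case: (complete_other w dD).
exists g => //; split.
  exists w; apply/concl_just_model/selected_concl_model => b.
  by rewrite -PiE; apply: wE.
move=> i u gi [uV uJ]; apply/negP => ui.
have : E (Neg (just (delta i))) by apply: contrapT => /asboolP; apply/negP.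
(* The valuation [complete (settle u)] would model [E] and satisfy the justification of [i], whose
   negation is in [E]. *)
have usg : concl_model delta V g (settle u) by exact: just_model_settle.
rewrite EE PiE => /(_ _ (concl_model_complete usg)) /= /negP; apply.
by apply: concl_just => //; rewrite complete_concl; apply: settle_concl.
Qed.

(** Were [i] unselected, maximality would refute its justification in every model of the selected
    ones; yet [settle u] is such a model and satisfies the entailed conclusion, hence the
    justification. *)
Lemma concl_selected g i : max_sel g -> entails g (concl (delta i)) ->
  selected_concls g (concl (delta i)).
Proof.
move=> [[u ug] gmax] gi; exists (delta i) => //; split=> //; left; exists i => //.
apply: contraT => /gmax gN; have su := just_model_settle ug.
by have /negP[] := gN _ (concl_just_model su); apply/concl_just/gi.
Qed.

Variable phi : form Sigma.
Hypothesis complete_phi : forall v,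
  feval (complete v) (embed phi) = feval v (embed phi).

Lemma credulousP :
  credulous T0 phi <-> exists g, max_sel g /\ entails g (embed phi).
Proof.
split=> [[E /extension_max_sel[g gmax ->]]|[g [gmax gphi]]].
  by move/Cn_selected => gphi; exists g; split=> //; apply: gphi.
by have [E Eext PiE] := max_sel_extension gmax; exists E => //; rewrite PiE Cn_selected.
Qed.

Lemma skepticalP :
  skeptical T0 phi <-> forall g, max_sel g -> entails g (embed phi).
Proof.
split=> [sk g gmax|gphi E /extension_max_sel[g gmax ->]]; last exact/Cn_selected/gphi.
have [E Eext PiE] := max_sel_extension gmax.
by rewrite -Cn_selected // -PiE; apply: sk.
Qed.

Lemma prudentP :
  prudent T0 phi <->
  forall g', (forall i, ~~ g' i -> exists g, max_sel g /\
                ~ entails g (concl (delta i))) -> entails g' (embed phi).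
Proof.
have PiP b : (\bigcap_(E in extensions T0) Pi T0 E) b <->
    forall g, max_sel g -> selected_concls g b.
  split=> [Eb g /max_sel_extension[E Eext <-]|gb E]; first exact: Eb.
  by move=> /extension_max_sel[g gmax ->]; apply: gb.
split=> [pr g' g'P u ug'|gP u uP].
  rewrite -complete_phi; apply: pr => b [bV|/PiP bP].
    by apply: (concl_model_complete ug'); left.
  (* Some maximal selection exists, so a common member of all [Pi_E] is known to be the conclusion
     of a default. *)
  have [v vV] := facts_consistent.
  have [g gmax] := maximal_selection_exists delta vV.
  have [d [dD _] db] := bP g gmax.
  case: (complete_other u dD) => [[i di]|]; last by rewrite db.
  (* If [i] were outside [g'], some maximal selection would fail to entail this conclusion, which
     all of them select. *)
  rewrite -db -di complete_concl; apply: ug'.2; apply: contraT => /g'P[h [hmax]].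
  case; apply/(Cn_selected _ (complete_concl i)) => w; apply; right.
  by rewrite di db; apply: bP.
(* The smallest selection that the hypothesis on [g'] admits. *)
pose g' i := `[< forall g, max_sel g -> entails g (concl (delta i)) >].
apply: (gP g') => [i /asboolP/existsNP[g /not_implyP[gmax gi]]|]; first by exists g.
split=> [|k /asboolP kP]; first by apply/allP => a aV; apply: uP; left.
by apply: uP; right; apply/PiP => g gmax; apply: concl_selected => //; apply: kP.
Qed.

End PrerequisiteFree.

(** * Replacement of atom occurrences according to polarity *)

Section Replacement.
Variables (A : eqType) (B : Type) (f : position -> bool -> A -> form B).

Lemma eq_feval_replace (v w : B -> bool) (a : form A) :
  (forall pi s p, p \in fvars a -> feval v (f pi s p) = feval w (f pi s p)) ->
  feval v (replace_occs f a) = feval w (replace_occs f a).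
Proof.
rewrite /replace_occs; move: [::] true.
elim: a => /= [p|b IHb|b IHb c IHc|b IHb c IHc|b IHb c IHc] pi s fvw.
- by apply: fvw; rewrite mem_head.
- by rewrite IHb.
all: by rewrite IHb ?IHc // => ? ? ? pa; apply: fvw; rewrite mem_cat pa ?orbT.
Qed.

(** When every occurrence takes its polarity as truth value, so does every subformula, and the whole
    formula is positive. *)
Lemma feval_replace_polarity (v : B -> bool) (a : form A) :
  (forall pi s p, feval v (f pi s p) = s) -> feval v (replace_occs f a).
Proof.
move=> fs; suff : forall pi s, feval v (replace_rec f pi s a) = s by move->.
elim: a => /= [p|b IHb|b IHb c IHc|b IHb c IHc|b IHb c IHc] pi s //.
- by rewrite IHb negbK.
all: by rewrite IHb IHc; case: s.
Qed.

End Replacement.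

Lemma occs_fvars (A : eqType) (a : form A) o : o \in occs a -> o.2 \in fvars a.
Proof.
rewrite /occs; move: [::] true.
elim: a => /= [p|b IHb|b IHb c IHc|b IHb c IHc|b IHb c IHc] pi s.
- by move=> /[!inE] /eqP->.
- exact: IHb.
all: by rewrite !mem_cat => /orP[/IHb->|/IHc->]; rewrite ?orbT.
Qed.

Lemma complementary_seq_vars (Sigma : eqType) (W : seq (form Sigma)) p :
  complementary W p -> p \in seq_vars W.
Proof.
move=> /andP[/hasP[a aW /hasP[o oa /andP[_ /eqP <-]]] _].
by apply: (fvars_seq_vars aW); apply: occs_fvars.
Qed.

(** * Signed default theories as instances of the general setting *)

Section SignedTheories.
Variables (Sigma : eqType) (W : seq (form Sigma)).
Implicit Types (x : satom Sigma) (v : satom Sigma -> bool) (p : Sigma).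

Definition base x : Sigma := (satom_encode x).1.

Lemma all_base s p :
  all (fun x => base x == p) s -> {in s, forall x, base x = p}.
Proof. by move=> /allP sp x /sp/eqP. Qed.

Definition is_orig x : bool := if x is Orig _ then true else false.

Definition signed_literals (f : position -> bool -> Sigma -> form (satom Sigma)) :=
  forall pi s p, exists x, [/\ ~~ is_orig x, base x = p
    & f pi s p = if s then Var x else Neg (Var x)].

Definition signed_default (C : pred Sigma) (d : default (satom Sigma)) p :=
  if C p then exists2 b, {in fvars b, forall x, base x = p} & d = normal_default p b
  else d = delta_ p.

(* The common shape of the three kinds of theories: the atoms in [C] are the
   ones handled by normal defaults. *)
Record signed_shape (C : pred Sigma) (T0 : theory (satom Sigma)) : Prop := {
  shape_facts : exists2 f, forall a, signed_literals (f a) &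
    facts T0 = [seq replace_occs (f a) a | a <- W];
  shape_defaults : forall d, defaults T0 d -> exists p, signed_default C d p;
  shape_vars : forall p, C p -> p \in seq_vars W }.

(** [C] is empty for [D_Sigma] and consists of the atoms with complementary occurrences for
    [D1_Sigma] and [D2_Sigma]. *)
Lemma signed_theories_shape T0 :
  signed_theories W T0 -> exists C, signed_shape C T0.
Proof.
have lit s p : exists x, [/\ ~~ is_orig x, base x = p
    & signed_lit s p = if s then Var x else Neg (Var x)].
  by case: s; [exists (Plus p) | exists (Minus p)].
have litI I : exists2 f, forall a, signed_literals (f a) &
    signed_setI W I = [seq replace_occs (f a) a | a <- W].
  eexists; last by [].
  move=> a pi s p /=; case: ifP => // _.
  by case: s; [exists (PlusI p (I (a, pi))) | exists (MinusI p (I (a, pi)))].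
case=> [|I _|I _].
- exists xpred0; split=> //= [|d [p _ <-]]; last by exists p.
  by eexists; last by []; move=> a pi; apply: lit.
- exists (complementary W); split=> [|d /= [p]|p] //=; last exact: complementary_seq_vars.
  rewrite /signed_default => dp; exists p; case: ifP dp => // _.
  move=> [i [j [_ _ ->]]]; exists (And (plus_eq p i) (minus_eq p j)) => //.
  by apply: all_base; rewrite /= /base /= !eqxx.
- exists (complementary W); split=> [|d /= [p]|p] //=; last exact: complementary_seq_vars.
  rewrite /signed_default => dp; exists p; case: ifP dp => // _.
  case=> [[i _ ->]|[j _ ->]]; [exists (plus_eq p i)|exists (minus_eq p j)] => //;
    by apply: all_base; rewrite /= /base /= !eqxx.
Qed.

Definition settle (C : pred Sigma) v x : bool :=
  if x is Orig p then if C p then v x else v (Plus p) else v x.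

(** Outside [W], [p^+] follows [p] and [p^-] its negation, as the conclusion of [delta_ p] demands.
    Original atoms stay fixed, so formulas over [Sigma] keep their values. *)
Definition complete v x : bool :=
  match x with
  | Plus p => if p \in seq_vars W then v x else v (Orig p)
  | Minus p => if p \in seq_vars W then v x else ~~ v (Orig p)
  | _ => v x
  end.

Lemma complete_id v (a : form (satom Sigma)) :
  {in fvars a, forall x, is_orig x || (base x \in seq_vars W)} ->
  feval (complete v) a = feval v a.
Proof. by move=> aP; apply: eq_in_feval => -[] p //= => [/aP|/aP] /= ->. Qed.

Lemma complete_embed v (phi : form Sigma) :
  feval (complete v) (embed phi) = feval v (embed phi).
Proof.
by elim: phi => //= [b ->|b -> c ->|b -> c ->|b -> c ->].
Qed.

Section Shape.
Variables (C : pred Sigma) (T0 : theory (satom Sigma)).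
Hypothesis T0C : signed_shape C T0.

Lemma shape_base d p : signed_default C d p ->
  {in dvars d, forall x, base x = p} /\ Orig p \in dvars d.
Proof.
rewrite /signed_default /dvars; case: ifP => _ => [[b bp ->]|->] /=.
  by split=> [x|]; rewrite !(inE, mem_cat) ?eqxx // => /or4P[/eqP->|/eqP->|/bp|/bp].
by split; [apply: all_base; rewrite /= /base /= !eqxx | rewrite inE eqxx].
Qed.

Lemma shape_pre d v : defaults T0 d -> feval v (pre d).
Proof.
move=> /(shape_defaults T0C)[p]; rewrite /signed_default.
by case: ifP => _ => [[b _ ->]|->] /=; apply: implybb.
Qed.

Lemma shape_concl_just d v :
  defaults T0 d -> feval v (concl d) -> feval v (just d).
Proof.
move=> /(shape_defaults T0C)[p]; rewrite /signed_default.
case: ifP => _ => [[b _ ->]|->] //=.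
by case: (v (Orig p)) (v (Plus p)) (v (Minus p)) => [] [] [].
Qed.

Lemma shape_consistent : exists v, all (feval v) (facts T0).
Proof.
have [f flit ->] := shape_facts T0C; exists xpredT; rewrite all_map; apply/allP.
move=> a _ /=; apply: feval_replace_polarity => pi s p.
by have [x [_ _ ->]] := flit a pi s p; case: s.
Qed.

Lemma settle_shape_facts v :
  all (feval v) (facts T0) -> all (feval (settle C v)) (facts T0).
Proof.
have [f flit ->] := shape_facts T0C; rewrite !all_map => /allP vW; apply/allP.
move=> a /vW /=; rewrite (@eq_feval_replace _ _ _ (settle C v) v) // => pi s p _.
by have [[q|q|q|q i|q i] [xN _ ->]] := flit a pi s p; case: s.
Qed.

(** For [delta_ p], setting [p] to [p^+] turns the justification into both equivalences of the
    conclusion. A normal default involves only atoms over its own [p], which [settle] leaves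
    alone. *)
Lemma settle_shape_concl d v : defaults T0 d ->
  feval v (just d) -> feval (settle C v) (concl d).
Proof.
move=> /(shape_defaults T0C)[p]; rewrite /signed_default.
case: ifP => Cp => [[b bp ->]|->] /=; last first.
  by rewrite Cp; case: (v (Plus p)) (v (Minus p)) => [] [].
rewrite (@eq_in_feval _ (settle C v) v) // => -[q|q|q|q i|q i] //= /bp.
by rewrite /base /= => ->; rewrite Cp.
Qed.

Lemma complete_shape_facts v :
  all (feval v) (facts T0) -> all (feval (complete v)) (facts T0).
Proof.
have [f flit ->] := shape_facts T0C; rewrite !all_map => /allP vW; apply/allP.
move=> a aW /=; rewrite (@eq_feval_replace _ _ _ (complete v) v); first exact: vW.
move=> pi s p pa; apply: complete_id => x.
have [y [_ yp ->]] := flit a pi s p; case: s; rewrite /= inE => /eqP->;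
  by rewrite yp (fvars_seq_vars aW pa) orbT.
Qed.

Lemma complete_shape_concl d v : defaults (restriction W T0) d ->
  feval (complete v) (concl d) = feval v (concl d).
Proof.
move=> [/(shape_defaults T0C)[p dp] [q [a [aW qa qd]]]].
(* All atoms of [d] lie over the single atom [p], which equals the atom [q] of [W]. *)
have [dv _] := shape_base dp; apply: complete_id => x xd.
rewrite (dv x) ?mem_cat ?xd ?orbT // -(dv _ qd).
by rewrite (fvars_seq_vars aW qa) orbT.
Qed.

(** As [C] stays within the atoms of [W], a default over an atom outside [W] is a [delta_ p]. *)
Lemma complete_shape_other d v : defaults T0 d ->
  defaults (restriction W T0) d \/ feval (complete v) (concl d).
Proof.
move=> dD; have [p dp] := shape_defaults T0C dD.
have [/flatten_mapP[a aW pa]|pW] := boolP (p \in seq_vars W).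
  by left; split=> //; exists p, a; split=> //; case: (shape_base dp).
right; move: dp; rewrite /signed_default; case: ifP => [/(shape_vars T0C)|_ ->].
  by rewrite (negbTE pW).
by rewrite /= (negbTE pW); case: (v (Orig p)).
Qed.

End Shape.

End SignedTheories.

(** * The three equivalences for signed theories *)

Theorem theorem7 (Sigma : eqType) (W : seq (form Sigma))
    (T0 T : theory (satom Sigma))
    (T0_in : signed_theories W T0) (T_restr : T = restriction W T0)
    (n : nat) (delta : 'I_n -> default (satom Sigma))
    (delta_inj : injective delta)
    (delta_enum : forall d, defaults T d <-> exists i, delta i = d)
    (phi : form Sigma) :
  [/\ credulous T0 phi <->
        valid (QExs (G n) (QAnd (Ext delta (facts T))
                                (Conseq delta (facts T) (embed phi)))),
      skeptical T0 phi <->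
        valid (QNeg (QExs (G n) (QAnd (Ext delta (facts T))
                                      (QNeg (Conseq delta (facts T) (embed phi))))))
    & prudent T0 phi <->
        valid (QNeg (QExs (G' n) (QAnd (QNeg (Conseq' delta (facts T) (embed phi)))
                                       (Psi delta (facts T)))))].
Proof.
have [C T0C] := signed_theories_shape T0_in; subst T.
have deltaR i : defaults (restriction W T0) (delta i).
  by apply/delta_enum; exists i.
have other d v : defaults T0 d ->
    (exists i, delta i = d) \/ feval (complete W v) (concl d).
  by rewrite -delta_enum; apply: (complete_shape_other T0C).
have cC i v := complete_shape_concl T0C v (deltaR i).
have pT := shape_pre T0C; have cJ := shape_concl_just T0C.
have dT i : defaults T0 (delta i) := (deltaR i).1.
have cons := shape_consistent T0C.
have sF := settle_shape_facts T0C; have sC := settle_shape_concl T0C.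
have cF := complete_shape_facts T0C; have cP := @complete_embed _ W.
split.
- rewrite valid_credulous /=.
  exact: (credulousP pT cJ dT cons sF sC cF cC other (cP^~ phi)).
- rewrite valid_skeptical /=.
  exact: (skepticalP pT cJ dT cons sF sC cF cC other (cP^~ phi)).
- rewrite valid_prudent /=.
  exact: (prudentP pT cJ dT cons sF sC cF cC other (cP^~ phi)).
Qed.
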